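(* Let $D\subset\mathbb{R}^d$ be a compact set whose convex hull contains the origin in its interior, let $\epsilon_0\in(0,1)$, and fix admissible training data $x_{-n_0+1},\dots,x_0\in\mathbb{R}^d$ for $(D,\epsilon_0)$. For a path $\xi=x_1x_2\cdots\in D^\infty$ put $s_N=x_1+\dots+x_N$, $V_N=\sum_{n=1}^N x_nx_n^{\mathrm t}$, and let $\lambda_{\max,N}$ and $\lambda_{\min,N}$ be the maximum and minimum eigenvalues of $V_N$. Let $E'$ be the event $$E':\quad \lim_{N\to\infty}\frac{\log\lambda_{\max,N}}{\lambda_{\min,N}}=0 .$$ Then by the sequential optimizing strategy Skeptic can weakly force $$E'\ \Rightarrow\ \limsup_{N\to\infty}\frac{s_N^{\mathrm t}V_N^{-1}s_N}{\log|V_N|}\le1 .$$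
   Context: Bounded forecasting game: Skeptic starts with capital $\mathcal K_0=1$; in each round $n=1,2,\dots$ Skeptic announces $\alpha_n\in\mathbb{R}^d$ (depending only on $x_1,\dots,x_{n-1}$), then Reality announces $x_n\in D$, and $\mathcal K_n=\mathcal K_{n-1}(1+\alpha_n\cdot x_n)$. Skeptic must keep $\mathcal K_n\ge0$ for all $n$ whatever Reality's moves. Vectors are columns, $^{\mathrm t}$ is transpose, $|V|$ is the determinant of the matrix $V$. Admissible training data: a finite list $x_{-n_0+1},\dots,x_0\in\mathbb{R}^d$ ($n_0\ge d+1$), chosen in advance by Skeptic, such that for every $\alpha\in\mathbb{R}^d$: if $1+\alpha\cdot x_n\ge 0$ for all $n=-n_0+1,\dots,0$, then $1+\alpha\cdot x\ge\epsilon_0$ for all $x\in D$. (This implies that the training vectors span $\mathbb{R}^d$.) For $N\ge0$ let $\Phi_{0,N}(\alpha)=\sum_{n=-n_0+1}^N\log(1+\alpha\cdot x_n)$. It has a unique maximizer $\alpha_N^*$, which lies in the interior of $\{\alpha: 1+\alpha\cdot x_n\ge0,\ n=-n_0+1,\dots,0\}$. The sequential optimizing strategy is $\alpha_n=\alpha_{n-1}^*$, $n\ge1$, with capital process $\mathcal K^*_{1,N}=\prod_{n=1}^N(1+\alpha_{n-1}^*\cdot x_n)$. Skeptic weakly forces an event $E\subset D^\infty$ by a strategy if the limsup of the capital process of that strategy is $+\infty$ for every $\xi\notin E$. An implication $E'\Rightarrow F$ between events denotes the event $(D^\infty\setminus E')\cup F$; so the claim is that $\limsup_N\mathcal K^*_{1,N}=\infty$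 for every path in $E'$ on which the stated limsup bound fails. *)

(* Defs.v *)
From HB Require Import structures.
From mathcomp Require Import all_boot all_order all_algebra.
From mathcomp Require Import all_classical all_reals all_analysis.

Set Implicit Arguments.
Unset Strict Implicit.
Unset Printing Implicit Defensive.

Import Order.TTheory GRing.Theory Num.Theory.
Import numFieldNormedType.Exports.

Local Open Scope classical_set_scope.
Local Open Scope ring_scope.

Definition dotv (R : realType) (d : nat) (u v : 'cV[R]_d) : R :=
  (u^T *m v) 0 0.

Definition convex_hull (R : realType) (d : nat) (D : set 'cV[R]_d) :
    set 'cV[R]_d :=
  smallest (@convex_set R 'cV[R]_d) D.

(* Paths are indexed from 0: [xi i] is Reality's move in round [i.+1]. *)
Definition path_in (R : realType) (d : nat) (D : set 'cV[R]_d) :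
    set (nat -> 'cV[R]_d) :=
  [set xi | forall i, D (xi i)].

(* A strategy maps the list of Reality's past moves to Skeptic's next move. *)
Definition strategy (R : realType) (d : nat) := seq 'cV[R]_d -> 'cV[R]_d.

Definition capital (R : realType) (d : nat) (P : strategy R d)
    (xi : nat -> 'cV[R]_d) (N : nat) : R :=
  \prod_(i < N) (1 + dotv (P (mkseq xi i)) (xi i)).

(* Skeptic's duty in the game with move space [D]. *)
Definition prudent (R : realType) (d : nat) (D : set 'cV[R]_d)
    (P : strategy R d) : Prop :=
  forall xi, path_in D xi -> forall N, 0 <= capital P xi N.

Definition weakly_forces (R : realType) (d : nat) (D : set 'cV[R]_d)
    (P : strategy R d) (E : set (nat -> 'cV[R]_d)) : Prop :=
  prudent D P /\
  forall xi, path_in D xi -> ~ E xi ->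
    limn_esup (fun N => (capital P xi N)%:E) = +oo%E.

Definition admissible (R : realType) (d : nat) (D : set 'cV[R]_d) (eps0 : R)
    (z : seq 'cV[R]_d) : Prop :=
  (d.+1 <= size z)%N /\
  forall a : 'cV[R]_d, (forall x, x \in z -> 0 <= 1 + dotv a x) ->
    forall x, D x -> eps0 <= 1 + dotv a x.

Definition log_capital (R : realType) (d : nat) (s : seq 'cV[R]_d)
    (a : 'cV[R]_d) : R :=
  \sum_(x <- s) ln (1 + dotv a x).

(* [ln] is 0 on nonpositive reals, so the natural domain of [log_capital s]
   has to be made explicit. *)
Definition log_capital_dom (R : realType) (d : nat) (s : seq 'cV[R]_d) :
    set 'cV[R]_d :=
  [set a | forall x, x \in s -> 0 < 1 + dotv a x].

Definition log_capital_maximizer (R : realType) (d : nat) (s : seq 'cV[R]_d) :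
    set 'cV[R]_d :=
  [set a | log_capital_dom s a /\
    forall b, log_capital_dom s b -> log_capital s b <= log_capital s a].

(* The default value 0 of [xget] is immaterial: for admissible training data
   [z] and a history in [D] the maximizer exists and is unique. *)
Definition sequential_optimizing (R : realType) (d : nat)
    (z : seq 'cV[R]_d) : strategy R d :=
  fun h => xget 0 (log_capital_maximizer (z ++ h)).

Definition sum_vec (R : realType) (d : nat) (xi : nat -> 'cV[R]_d) (N : nat) :
    'cV[R]_d :=
  \sum_(i < N) xi i.

Definition sum_sq (R : realType) (d : nat) (xi : nat -> 'cV[R]_d) (N : nat) :
    'M[R]_d :=
  \sum_(i < N) (xi i *m (xi i)^T).

(* For a symmetric matrix of positive size the spectrum is finite and nonempty,
   so this supremum (infimum) is the largest (smallest) eigenvalue. *)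
Definition lambda_max (R : realType) (d : nat) (A : 'M[R]_d) : R :=
  sup [set a | eigenvalue A a].

Definition lambda_min (R : realType) (d : nat) (A : 'M[R]_d) : R :=
  inf [set a | eigenvalue A a].

(* As [x / 0 = 0], the positivity clause is what makes the limit meaningful: it
   says that the quotient is defined for all large [N]. *)
Definition eigenvalue_event (R : realType) (d : nat) :
    set (nat -> 'cV[R]_d) :=
  [set xi | (\forall N \near \oo, 0 < lambda_min (sum_sq xi N)) /\
    (fun N => ln (lambda_max (sum_sq xi N)) / lambda_min (sum_sq xi N))
      @ \oo --> (0 : R)].

Definition self_normalized_event (R : realType) (d : nat) :
    set (nat -> 'cV[R]_d) :=
  [set xi | (limn_esup (fun N =>
      (((sum_vec xi N)^T *m invmx (sum_sq xi N) *m sum_vec xi N) 0 0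
        / ln (\det (sum_sq xi N)))%:E) <= 1%:E)%E].

(* Main.v *)
(* Let [a_N] maximize [Phi_N a = \sum ln (1 + a.x)] over the training data and
   the first [N] moves, [V_N = \sum x_i x_i^T] and [G_N = ln (\det V_N)]. As
   [a_n] and [a_(n+1)] maximize consecutive potentials,
     ln K_N = Phi_N a_N - Phi_0 a_0
       - \sum_(n < N) (Phi_(n+1) a_(n+1) - Phi_(n+1) a_n).
   If all factors [1 + a.x] lie in [[m, M]], the strong concavity of [ln] on
   [(0, M]] bounds each gain by [M^2 / (2 m^2) * x_n^T V_(n+1)^-1 x_n], hence by
   [M^2 / (2 m^2) * (G_(n+1) - G_n)], and yields
   [a_N^T V_N a_N <= 2 M^2 Phi_N a_N].
   If the capital is bounded, then [lambda_min |a_N|^2 = O(1 + G_N)], and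
   [G_N <= d ln lambda_max], so on the eigenvalue event [a_N] tends to 0. Then
   [m] and [M] may be taken close to 1: the total gain is at most
   [(1/2 + o(1)) G_N], whereas stationarity at [a_N] gives
   [Phi_N a_N >= (1/2 - o(1)) s_N^T V_N^-1 s_N]. Hence the ratio of
   [s_N^T V_N^-1 s_N] to [G_N] cannot exceed [1 + rho] infinitely often. *)
Require Import Defs.
From mathcomp Require Import all_boot all_order all_algebra.
From mathcomp Require Import all_classical all_reals all_analysis.
From mathcomp Require Import ring lra.
Import Order.TTheory GRing.Theory Num.Theory.
Import numFieldNormedType.Exports.
Local Open Scope classical_set_scope.
Local Open Scope ring_scope.

Set Implicit Arguments.
Unset Strict Implicit.
Unset Printing Implicit Defensive.

(** * Quadratic forms and determinants *)

Section Dot.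
Context {R : realType} {d : nat}.
Implicit Types (u v w : 'cV[R]_d) (V : 'M[R]_d) (c : R).

Lemma dotvE u v : dotv u v = \sum_i u i 0 * v i 0.
Proof. by rewrite /dotv mxE; apply: eq_bigr => i _; rewrite mxE. Qed.

Lemma dotvC u v : dotv u v = dotv v u.
Proof. by rewrite !dotvE; apply: eq_bigr => i _; rewrite mulrC. Qed.

Lemma dotvDr u v w : dotv u (v + w) = dotv u v + dotv u w.
Proof. by rewrite /dotv mulmxDr mxE. Qed.

Lemma dotvNr u v : dotv u (- v) = - dotv u v.
Proof. by rewrite /dotv mulmxN mxE. Qed.

Lemma dotvZr c u v : dotv u (c *: v) = c * dotv u v.
Proof. by rewrite /dotv -scalemxAr mxE. Qed.

Lemma dotvDl u v w : dotv (u + v) w = dotv u w + dotv v w.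
Proof. by rewrite dotvC dotvDr !(dotvC w). Qed.

Lemma dotvNl u v : dotv (- u) v = - dotv u v.
Proof. by rewrite dotvC dotvNr dotvC. Qed.

Lemma dotvZl c u v : dotv (c *: u) v = c * dotv u v.
Proof. by rewrite dotvC dotvZr dotvC. Qed.

Lemma dotv0 u : dotv u 0 = 0.
Proof. by rewrite /dotv mulmx0 mxE. Qed.

Lemma dot0v u : dotv 0 u = 0.
Proof. by rewrite dotvC dotv0. Qed.

Lemma dotv_sumr (I : Type) (r : seq I) (F : I -> 'cV[R]_d) u :
  dotv u (\sum_(i <- r) F i) = \sum_(i <- r) dotv u (F i).
Proof. by rewrite /dotv mulmx_sumr summxE. Qed.

Lemma dotv_delta u i : dotv u (delta_mx i 0) = u i 0.
Proof.
rewrite dotvE (bigD1 i) //= mxE !eqxx mulr1 big1 ?addr0 // => j ji.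
by rewrite mxE (negbTE ji) mulr0.
Qed.

Lemma dotvv_ge0 u : 0 <= dotv u u.
Proof. by rewrite dotvE; apply: sumr_ge0 => i _; rewrite -expr2 sqr_ge0. Qed.

Lemma sqr_coord_le u i : u i 0 ^+ 2 <= dotv u u.
Proof.
rewrite dotvE (bigD1 i) //= -expr2 lerDl.
by apply: sumr_ge0 => j _; rewrite -expr2 sqr_ge0.
Qed.

Lemma dotvv_eq0 u : (dotv u u == 0) = (u == 0).
Proof.
apply/eqP/eqP => [u0|->]; last exact: dotv0.
apply/colP => i; rewrite mxE; apply/eqP; rewrite -sqrf_eq0 eq_le sqr_ge0 andbT.
by rewrite -u0 sqr_coord_le.
Qed.

Lemma dotv_mulmxC V u v : dotv u (V *m v) = dotv (V^T *m u) v.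
Proof. by rewrite /dotv trmx_mul trmxK mulmxA. Qed.

Lemma dotv_rank1 x u v : dotv u (x *m x^T *m v) = dotv u x * dotv x v.
Proof. by rewrite /dotv !mulmxA -mulmxA [LHS]mxE big_ord1. Qed.

End Dot.

Section QuadraticForms.
Context {R : realType}.

Lemma form_addE d (V : 'M[R]_d) (s t : R) u v : V^T = V ->
  dotv (s *: u + t *: v) (V *m (s *: u + t *: v)) =
  s ^+ 2 * dotv u (V *m u) + 2 * s * t * dotv u (V *m v)
  + t ^+ 2 * dotv v (V *m v).
Proof.
move=> sV; have vu : dotv v (V *m u) = dotv u (V *m v).
  by rewrite dotv_mulmxC sV dotvC.
rewrite mulmxDr -!scalemxAr !(dotvDl, dotvDr) !(dotvZl, dotvZr) vu; ring.
Qed.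

Lemma psd_cauchy_schwarz d (V : 'M[R]_d) u v : V^T = V ->
  (forall w, 0 <= dotv w (V *m w)) ->
  dotv u (V *m v) ^+ 2 <= dotv u (V *m u) * dotv v (V *m v).
Proof.
move=> sV V0.
have P s t := form_addE s t u v sV.
have Q s t : 0 <= s ^+ 2 * dotv u (V *m u) + 2 * s * t * dotv u (V *m v)
  + t ^+ 2 * dotv v (V *m v) by rewrite -P.
have := V0 u; have := V0 v.
move: (dotv u (V *m u)) (dotv u (V *m v)) (dotv v (V *m v)) Q => c b a Q a0 c0.
(* The first two instances read [a * (a * c - b ^+ 2) >= 0] and [c * (a * c - b ^+ 2) >= 0], which
   settles a nonzero [a] or [c]; if both vanish, the last two force [b = 0]. *)
have := Q a (- b); have := Q (- b) c; have := Q 1 1; have := Q 1 (- 1).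
move: a0 c0; rewrite le_eqVlt => /orP[/eqP<-|a0]; last by move=> *; nra.
by rewrite le_eqVlt => /orP[/eqP<-|c0] *; nra.
Qed.

Lemma cauchy_schwarz d (u v : 'cV[R]_d) :
  dotv u v ^+ 2 <= dotv u u * dotv v v.
Proof.
have := @psd_cauchy_schwarz d 1%:M u v (trmx1 _ _); rewrite !mul1mx; apply.
by move=> w; rewrite mul1mx dotvv_ge0.
Qed.

(** A spectral lower bound phrased without eigenvalues: in this form it passes to Schur complements
    and survives adding [x *m x^T]. *)
Definition coercive d (l : R) (V : 'M[R]_d) :=
  forall u, l * dotv u u <= dotv u (V *m u).

Lemma schur_det n (a : R) (b : 'cV[R]_n) (C : 'M[R]_n) : a != 0 ->
  \det (block_mx a%:M b^T b C) = a * \det (C - a^-1 *: (b *m b^T)).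
Proof.
move=> a0; pose T : 'M[R]_(1 + n) := block_mx 1%:M (- a^-1 *: b^T) 0 1%:M.
have dT : \det T = 1 by rewrite det_ublock !det1 mulr1.
rewrite -[LHS]mulr1 -dT -det_mulmx mulmx_block !mulmx0 !mulmx1 !addr0.
rewrite -scalemxAr mul_scalar_mx scalerA mulNr mulVf // scaleN1r addNr.
by rewrite det_lblock det_scalar1 scaleNr mulmxN -scalemxAr addrC.
Qed.

Lemma dotv_col_mxE n (s t : R) (u v : 'cV[R]_n) :
  dotv (col_mx s%:M u) (col_mx t%:M v) = s * t + dotv u v.
Proof.
rewrite /dotv tr_col_mx mul_row_col [LHS]mxE; congr (_ + _).
by rewrite tr_scalar_mx -scalar_mxM mxE eqxx mulr1n.
Qed.

Lemma dotv_col_mx n (t : R) (v : 'cV[R]_n) :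
  dotv (col_mx t%:M v) (col_mx t%:M v) = t ^+ 2 + dotv v v.
Proof. by rewrite dotv_col_mxE expr2. Qed.

Lemma schur_form n (a : R) (b : 'cV[R]_n) (C : 'M[R]_n) t v :
  dotv (col_mx t%:M v) (block_mx a%:M b^T b C *m col_mx t%:M v) =
  a * t ^+ 2 + 2 * t * dotv b v + dotv v (C *m v).
Proof.
have -> : block_mx a%:M b^T b C *m col_mx t%:M v =
    col_mx (a * t + dotv b v)%:M (t *: b + C *m v).
  rewrite mul_block_col !mul_mx_scalar scale_scalar_mx mulrC;
    congr (col_mx _ _).
  by rewrite raddfD /= /dotv -mx11_scalar.
by rewrite dotv_col_mxE dotvDr dotvZr (dotvC v b); ring.
Qed.

Lemma sym_blockE n (V : 'M[R]_(1 + n)) : V^T = V ->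
  exists a b C, V = block_mx a%:M b^T b C /\ C^T = C.
Proof.
move=> sV; exists (ulsubmx V 0 0), (dlsubmx V), (drsubmx V); split; last first.
  by rewrite trmx_drsub sV.
by rewrite trmx_dlsub sV -mx11_scalar submxK.
Qed.

(** The first coordinate [- a^-1 * dotv b v] is the critical point of the block form for fixed
    [v]. *)
Lemma schur_form_min n (a : R) (b : 'cV[R]_n) (C : 'M[R]_n) v : a != 0 ->
  dotv v ((C - a^-1 *: (b *m b^T)) *m v) =
  dotv (col_mx ((- a^-1 * dotv b v)%:M) v)
    (block_mx a%:M b^T b C *m col_mx ((- a^-1 * dotv b v)%:M) v).
Proof.
move=> a0; rewrite schur_form mulmxBl dotvDr dotvNr -scalemxAl dotvZr.
by rewrite dotv_rank1 (dotvC v b); field.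
Qed.

(** The vector [(1, 0)] bounds the pivot; the completed vector of [schur_form_min] bounds the
    complement, being at least as long as [v]. *)
Lemma schur_coercive n l (a : R) (b : 'cV[R]_n) (C : 'M[R]_n) : 0 < l ->
  coercive l (block_mx a%:M b^T b C : 'M[R]_(1 + n)) ->
  l <= a /\ coercive l (C - a^-1 *: (b *m b^T)).
Proof.
move=> l0 cV.
have la : l <= a.
  have := cV (col_mx 1%:M 0); rewrite schur_form dotv_col_mx !dotv0.
  by rewrite mulmx0 dotv0; lra.
split=> // v; rewrite schur_form_min;
  last by rewrite gt_eqF // (lt_le_trans l0).
apply: le_trans (cV _); rewrite dotv_col_mx ler_pM2l // lerDr.
exact: sqr_ge0.
Qed.

(** Induction on Schur complements: each of the [n] pivots is at least [l]. *)
Lemma det_ge_coercive n l (V : 'M[R]_n) : 0 < l -> V^T = V -> coercive l V ->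
  l ^+ n <= \det V.
Proof.
move=> l0; elim: n V => [|n IH] V sV cV; first by rewrite det_mx00 expr0.
have [a [b [C [VE sC]]]] := @sym_blockE n V sV.
move: cV; rewrite [V]VE => /(schur_coercive l0)[la cS].
rewrite schur_det; last by rewrite gt_eqF // (lt_le_trans l0).
rewrite exprS ler_pM ?exprn_ge0 ?(ltW l0) //; apply: IH => //.
by rewrite linearB linearZ /= trmx_mul trmxK sC.
Qed.

Lemma coercive_det_gt0 n l (V : 'M[R]_n) : 0 < l -> V^T = V -> coercive l V ->
  0 < \det V.
Proof.
by move=> l0 sV cV; apply: lt_le_trans (det_ge_coercive l0 sV cV);
  rewrite exprn_gt0.
Qed.

Lemma coercive_unitmx n l (V : 'M[R]_n) : 0 < l -> V^T = V -> coercive l V ->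
  V \in unitmx.
Proof.
by move=> l0 sV cV; rewrite unitmxE unitfE gt_eqF // (coercive_det_gt0 l0 sV
  cV).
Qed.

(** The same elimination from above: coercivity keeps the pivots positive, and the complement stays
    below [L], being [C] minus a positive semidefinite term. *)
Lemma det_le_bounded n l L (V : 'M[R]_n) : 0 < l -> V^T = V -> coercive l V ->
  (forall u, dotv u (V *m u) <= L * dotv u u) -> \det V <= L ^+ n.
Proof.
move=> l0; elim: n V => [|n IH] V sV cV VL; first by rewrite det_mx00 expr0.
have [a [b [C [VE sC]]]] := @sym_blockE n V sV.
move: cV VL; rewrite [V]VE => /(schur_coercive l0)[la cS] VL.
have a0 : 0 < a by apply: lt_le_trans la.
have aL : a <= L.
  have := VL (col_mx 1%:M 0 : 'cV[R]_(1 + n));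
    rewrite schur_form dotv_col_mx !dotv0.
  by rewrite mulmx0 dotv0; lra.
have sS : (C - a^-1 *: (b *m b^T))^T = C - a^-1 *: (b *m b^T).
  by rewrite linearB linearZ /= trmx_mul trmxK sC.
rewrite schur_det ?gt_eqF // exprS ler_pM ?(ltW a0) //.
  exact/ltW/(coercive_det_gt0 l0).
apply: IH => // v; have := VL (col_mx 0%:M v : 'cV[R]_(1 + n)).
rewrite schur_form dotv_col_mx expr0n /= !(mulr0, mul0r) !add0r.
apply: le_trans; rewrite mulmxBl dotvDr dotvNr -scalemxAl dotvZr dotv_rank1.
rewrite gerDl oppr_le0 mulr_ge0 ?invr_ge0 ?(ltW a0) // (dotvC v) -expr2.
exact: sqr_ge0.
Qed.

(** One bordered determinant computed twice: clearing [- y^T] leaves [V + x *m y^T], clearing [x]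
    leaves [V] and the scalar factor. *)
Lemma det_rank1 n (V : 'M[R]_n) (x y : 'cV[R]_n) : V \in unitmx ->
  \det (V + x *m y^T) = \det V * (1 + dotv y (invmx V *m x)).
Proof.
move=> uV; pose M : 'M[R]_(1 + n) := block_mx 1%:M (- y^T) x V.
pose T1 : 'M[R]_(1 + n) := block_mx 1%:M y^T 0 1%:M.
pose T2 : 'M[R]_(1 + n) := block_mx 1%:M 0 (- (invmx V *m x)) 1%:M.
have d1 : \det (M *m T1) = \det (V + x *m y^T).
  rewrite mulmx_block !mulmx0 !mulmx1 !addr0 mul1mx subrr det_lblock det1.
  by rewrite mul1r addrC.
have d2 : \det (M *m T2) = \det V * (1 + dotv y (invmx V *m x)).
  rewrite mulmx_block !mulmx0 !mulmx1 !add0r !mulmxN mulKVmx //.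
  rewrite subrr det_ublock mulrC mulNmx opprK; congr (_ * _).
  by rewrite [_ + _]mx11_scalar det_scalar1 [LHS]mxE mxE eqxx.
rewrite -d1 -d2 !det_mulmx; congr (_ * _).
by rewrite det_ublock det_lblock.
Qed.

(* The rank-one update gives [det V = det (V + x x^T) * (1 - q)] with
   [q = x^T (V + x x^T)^-1 x], and [ln (1 - q) <= - q]. *)
Lemma ln_det_rank1 n l (V : 'M[R]_n) (x : 'cV[R]_n) : 0 < l -> V^T = V ->
  coercive l V ->
  dotv x (invmx (V + x *m x^T) *m x) <= ln (\det (V + x *m x^T)) - ln (\det V).
Proof.
move=> l0 sV cV; set W := V + _.
have sW : W^T = W by rewrite /W linearD /= sV trmx_mul trmxK.
have cW : coercive l W.
  move=> u; apply: le_trans (cV u) _.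
  by rewrite /W mulmxDl dotvDr dotv_rank1 lerDl (dotvC x) -expr2 sqr_ge0.
have dW := coercive_det_gt0 l0 sW cW; have dV := coercive_det_gt0 l0 sV cV.
have VE : \det V = \det W * (1 - dotv x (invmx W *m x)).
  rewrite -dotvNr -mulmxN -det_rank1 ?(coercive_unitmx l0) //.
  by rewrite /W mulNmx addrK.
set q := dotv x _ in VE *.
have q1 : 0 < 1 - q by move: dV; rewrite VE pmulr_rgt0.
rewrite VE lnM ?posrE // opprD addrA subrr add0r lerNr.
by rewrite le_ln1Dx // ltrN2 -subr_gt0.
Qed.

(** Nonnegativity of the [V]-form at [c *: v - invmx V *m y]. The bound is uniform in [v], which
    will be the unknown change of the maximizer. *)
Lemma complete_square n l (V : 'M[R]_n) (c : R) (y v : 'cV[R]_n) : 0 < l ->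
  V^T = V -> coercive l V -> 0 < c ->
  dotv y v - c / 2 * dotv v (V *m v) <= (2 * c)^-1 * dotv y (invmx V *m y).
Proof.
move=> l0 sV cV c0.
have := cV (c *: v + (- 1) *: (invmx V *m y)).
rewrite form_addE // mulKVmx ?(coercive_unitmx l0) // (dotvC v y) (dotvC (_ *m
  y) y).
move=> /(le_trans (mulr_ge0 (ltW l0) (dotvv_ge0 _))).
set p := dotv y v; set q := dotv v _; set r := dotv y _ => H.
rewrite -subr_ge0.
have -> : (2 * c)^-1 * r - (p - c / 2 * q) =
  (2 * c)^-1 * (c ^+ 2 * q + 2 * c * -1 * p + (-1) ^+ 2 * r).
  by field; rewrite gt_eqF.
by rewrite mulr_ge0 // invr_ge0 mulr_ge0 // ltW.
Qed.

End QuadraticForms.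

(** * Eigenvalues, logarithms and upper limits *)

Section RowVectors.
Context {R : realType} {d : nat}.

Lemma continuous_sum_seq (T : topologicalType) (I : Type) (r : seq I)
    (F : I -> T -> R) : (forall i, continuous (F i)) ->
  continuous (fun t => \sum_(i <- r) F i t).
Proof.
by move=> cF; apply: continuous_big => [|i _];
  [exact: add_continuous|exact: cF].
Qed.

Lemma continuous_prod_seq (T : topologicalType) (I : Type) (r : seq I)
    (F : I -> T -> R) : (forall i, continuous (F i)) ->
  continuous (fun t => \prod_(i <- r) F i t).
Proof.
by move=> cF; apply: continuous_big => [|i _];
  [exact: mul_continuous|exact: cF].
Qed.

Lemma continuous_mul (T : topologicalType) (f g : T -> R) :
  continuous f -> continuous g -> continuous (fun t => f t * g t).
Proof. by move=> cf cg t; exact: cvgM (cf t) (cg t). Qed.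

Lemma continuous_addl (T : topologicalType) (c : R) (f : T -> R) :
  continuous f -> continuous (fun t => c + f t).
Proof. by move=> cf t; apply: cvgD (cf t); exact: cvg_cst. Qed.

Lemma continuous_rowE i : continuous (fun r : 'rV[R]_d => r 0 i).
Proof. exact: (@coord_continuous R 1 d 0 i). Qed.

Lemma continuous_dotv (x : 'cV[R]_d) :
  continuous (fun r : 'rV[R]_d => dotv r^T x).
Proof.
have -> : (fun r : 'rV[R]_d => dotv r^T x) =
    (fun r : 'rV[R]_d => \sum_i r 0 i * x i 0).
  by apply/funext => r; rewrite dotvE; apply: eq_bigr => i _; rewrite mxE.
apply: continuous_sum_seq => i.
by apply: continuous_mul; [exact: continuous_rowE|exact: cst_continuous].
Qed.

Lemma continuous_form (V : 'M[R]_d) :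
  continuous (fun r : 'rV[R]_d => dotv r^T (V *m r^T)).
Proof.
have -> : (fun r : 'rV[R]_d => dotv r^T (V *m r^T)) =
    (fun r : 'rV[R]_d => \sum_i r 0 i * \sum_j V i j * r 0 j).
  apply/funext => r; rewrite dotvE; apply: eq_bigr => i _; rewrite !mxE.
  by congr (_ * _); apply: eq_bigr => j _; rewrite mxE.
apply: continuous_sum_seq => i; apply: continuous_mul;
  first exact: continuous_rowE.
apply: continuous_sum_seq => j.
by apply: continuous_mul; [exact: cst_continuous|exact: continuous_rowE].
Qed.

Lemma closed_bounded_compact_rV (A : set 'rV[R]_d) (B : R) :
  closed A -> (forall r, A r -> dotv r^T r^T <= B) -> compact A.
Proof.
move=> cA AB; apply: bounded_closed_compact => //.
exists (1 + B); split; first exact: num_real.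
move=> M BM r /AB rB; apply: le_trans (ltW BM).
have B0 : 0 <= B by apply: le_trans rB; exact: dotvv_ge0.
rewrite [leLHS]/Num.norm /= mx_normrE; apply: bigmax_le => [|[i j] _ /=].
  by lra.
rewrite (ord1 i); have := le_trans (sqr_coord_le r^T j) rB.
rewrite mxE -real_normK ?num_real //; have := normr_ge0 (r 0 j).
by move: `|_| => c; nra.
Qed.

End RowVectors.

Section Rayleigh.
Context {R : realType} {d : nat}.
Implicit Types V : 'M[R]_d.

(* The minimum of the Rayleigh quotient is attained at an eigenvector. *)
Lemma rayleigh_min V : (0 < d)%N -> V^T = V ->
  exists2 m, eigenvalue V m & coercive m V.
Proof.
move=> d0 sV; pose S := [set r : 'rV[R]_d | dotv r^T r^T = 1].
have cS : compact S.
  apply: (@closed_bounded_compact_rV _ _ _ 1) => [|r -> //].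
  have : continuous (fun r : 'rV[R]_d => dotv r^T r^T).
    have := @continuous_form R d 1%:M.
    by under eq_fun do rewrite mul1mx.
  move=> /continuous_closedP/(_ [set 1]); apply.
  exact: (accessible_closed_set1 (hausdorff_accessible (@Rhausdorff R))).
have S0 : S !=set0.
  case: d d0 @S {cS} => // n _ S; exists (delta_mx 0 0); rewrite /S /=.
  by rewrite trmx_delta dotv_delta mxE !eqxx.
have [w /set_mem Sw wmin] := EVT_min_rV S0 cS
  (continuous_subspaceT (@continuous_form R d V)).
set m := dotv w^T (V *m w^T) in wmin.
have cm : coercive m V.
  move=> u; have [->|u0] := eqVneq u 0; first by rewrite !dot0v mulr0.
  have uu : 0 < dotv u u by rewrite lt_neqAle eq_sym dotvv_eq0 u0 dotvv_ge0.
  pose s := (Num.sqrt (dotv u u))^-1.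
  have s2 : s ^+ 2 = (dotv u u)^-1 by rewrite exprVn sqr_sqrtr ?ltW.
  have := wmin ((s *: u)^T); rewrite !trmxK.
  rewrite -scalemxAr !(dotvZl, dotvZr) mulrA -expr2 s2.
  rewrite mulrC ler_pdivlMr //; apply; apply/mem_set; rewrite /S /=.
  by rewrite trmxK dotvZl dotvZr mulrA -expr2 s2 mulVf // gt_eqF.
exists m => //; apply/eigenvalueP; exists w; last first.
  apply/eqP => w0; move: Sw; rewrite /S /= w0 trmx0 dotv0 => /eqP.
  by rewrite eq_sym oner_eq0.
(* [W] is positive semidefinite and its form vanishes at the minimizer, so Cauchy-Schwarz for [W]
   forces [W *m w^T = 0]. *)
pose W := V - m%:M.
have WE u v : dotv u (W *m v) = dotv u (V *m v) - m * dotv u v.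
  by rewrite /W mulmxBl mul_scalar_mx dotvDr dotvNr dotvZr.
have Ww : W *m w^T = 0.
  apply/eqP; rewrite -dotvv_eq0 -sqrf_eq0 eq_le sqr_ge0 andbT.
  apply: le_trans (@psd_cauchy_schwarz _ _ W _ _ _ _) _.
  - by rewrite /W linearB /= sV tr_scalar_mx.
  - by move=> u; rewrite WE subr_ge0; exact: cm.
  - by rewrite (WE w^T) Sw mulr1 subrr mulr0.
move: Ww; rewrite /W mulmxBl mul_scalar_mx => /subr0_eq/(congr1 trmx).
by rewrite trmx_mul !trmxK linearZ /= trmxK sV.
Qed.

Lemma coercive_eigenvalue_ge V l a : coercive l V -> V^T = V ->
  eigenvalue V a -> l <= a.
Proof.
move=> cV sV /eigenvalueP[w wV w0].
have := cV w^T; rewrite -[V in V *m _]sV -trmx_mul wV linearZ /= dotvZr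
  ler_pM2r //.
by rewrite lt_neqAle dotvv_ge0 eq_sym dotvv_eq0 trmx_eq0 w0.
Qed.

Lemma lambda_min_coercive V : (0 < d)%N -> V^T = V -> coercive (lambda_min V) V.
Proof.
move=> d0 sV; have [m em cm] := rayleigh_min d0 sV.
move=> u; apply: le_trans (cm u); rewrite ler_wpM2r ?dotvv_ge0 //.
apply: ge_inf => //; exists m => a ea.
exact: (coercive_eigenvalue_ge cm).
Qed.

(** [rayleigh_min] applied to [- V], whose eigenvalues are the negatives of those of [V]. *)
Lemma lambda_max_ge V u : (0 < d)%N -> V^T = V ->
  dotv u (V *m u) <= lambda_max V * dotv u u.
Proof.
move=> d0 sV; have sN : (- V)^T = - V by rewrite linearN /= sV.
have eN a : eigenvalue V a -> eigenvalue (- V) (- a).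
  move=> /eigenvalueP[w wV w0]; apply/eigenvalueP; exists w => //.
  by rewrite mulmxN wV scaleNr.
have eN' a : eigenvalue (- V) a -> eigenvalue V (- a).
  move=> /eigenvalueP[w wV w0]; apply/eigenvalueP; exists w => //.
  by rewrite scaleNr -wV mulmxN opprK.
have [m em cm] := rayleigh_min d0 sN.
have := cm u; rewrite mulNmx dotvNr lerNr -mulNr => /le_trans; apply.
rewrite ler_wpM2r ?dotvv_ge0 //; apply: ub_le_sup; last exact: eN'.
exists (- m) => a /eN ea; rewrite lerNr; exact: (coercive_eigenvalue_ge cm).
Qed.

End Rayleigh.

Section Logarithm.
Context {R : realType}.

(* The difference of the two sides vanishes at [w = u], and its derivative in
   [w] is [(w - u) (1 / (u w) - 1 / M ^+ 2)]. *)
Lemma ln_le_quadratic (M u w : R) : 0 < u -> 0 < w -> u <= M -> w <= M ->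
  ln w - ln u <= (w - u) / u - (w - u) ^+ 2 / (2 * M ^+ 2).
Proof.
move=> u0 w0 uM wM; have M0 : 0 < M by apply: lt_le_trans uM.
pose K := (2 * M ^+ 2)^-1.
pose f (x : R) : R := u^-1 * (x - u) - K * (x - u) ^+ 2 - (ln x - ln u).
pose df (x : R) : R := (x - u) * ((u * x)^-1 - (M ^+ 2)^-1).
have fder (x : R) : 0 < x -> is_derive x 1 f (df x).
  move=> x0; have D1 : is_derive x 1 (fun x : R => x - u) 1.
    have := is_deriveB (is_derive_id x (1 : R)) (is_derive_cst u x (1 : R)).
    by rewrite subr0.
  have D2 := is_deriveB (is_derive1_ln x0) (is_derive_cst (ln u) x (1 : R)).
  have := is_deriveB (is_deriveB (is_deriveZ u^-1 D1)
    (is_deriveZ K (is_deriveM D1 D1))) D2.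
  suff <- : (u^-1 *: 1 - K *: ((x - u) *: (1 : R) + (x - u) *: (1 : R))
      - (x^-1 - 0) : R) = df x by [].
  by rewrite /GRing.scale /= /df /K; field; rewrite !gt_eqF.
have fu : f u = 0 by rewrite /f !subrr expr0n /= !mulr0 !subrr.
suff : 0 <= f w by rewrite /f subr_ge0 (mulrC u^-1) (mulrC K).
have cont a b : 0 < a -> {within `[a, b], continuous f}.
  move=> a0; apply: derivable_within_continuous => x;
    rewrite in_itv /= => /andP[ax _].
  by have [] := fder x (lt_le_trans a0 ax).
have df_sign x : 0 < x -> x <= M -> 0 <= (u * x)^-1 - (M ^+ 2)^-1.
  move=> x0 xM; rewrite subr_ge0 lef_pV2 ?posrE ?mulr_gt0 ?exprn_gt0 //.
  by rewrite expr2 ler_pM // ltW.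
have [uw|wu|<-] := ltgtP u w; last by rewrite fu.
- have fd x : x \in `]u, w[ -> is_derive x 1 f (df x).
    by rewrite in_itv => /andP[ax _]; apply: fder; apply: lt_trans ax.
  have [c] := MVT uw fd (cont _ _ u0).
  rewrite in_itv /= fu subr0 => /andP[uc cw] ->.
  by rewrite mulr_ge0 ?mulr_ge0 ?df_sign ?subr_ge0 ?ltW // ?(lt_trans u0)
    ?(lt_le_trans cw).
- have fd x : x \in `]w, u[ -> is_derive x 1 f (df x).
    by rewrite in_itv => /andP[ax _]; apply: fder; apply: lt_trans ax.
  have [c] := MVT wu fd (cont _ _ w0).
  rewrite in_itv /= fu sub0r => /andP[wc cu] /eqP; rewrite eqr_oppLR => /eqP ->.
  rewrite -mulNr mulr_ge0 ?subr_ge0 ?(ltW wu) // /df -mulNr opprB.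
  by rewrite mulr_ge0 ?subr_ge0 ?(ltW cu) // -subr_ge0 df_sign ?(lt_trans w0)
    ?(le_trans (ltW cu)).
Qed.

End Logarithm.

Section Limsup.
Context {R : realType}.
Implicit Types u : nat -> R.

Lemma limn_esup_pinfty u :
  (forall C n, exists2 N, (n <= N)%N & C <= u N) ->
  limn_esup (fun N => (u N)%:E) = +oo%E.
Proof.
move=> uC; apply/eqP; rewrite -leye_eq /limn_esup /limf_esup.
apply: le_ereal_inf_tmp => _ [A [n _ nA] <-].
rewrite leye_eq; apply/eqP/eqyP => C C0.
have [N nN CN] := uC C n; apply: (@le_trans _ _ (u N)%:E).
  by rewrite lee_fin.
by apply: ereal_sup_ubound; exists N => //; exact: nA.
Qed.

Lemma limn_esup_le1 u : (forall rho, 0 < rho ->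
    exists n, forall N, (n <= N)%N -> u N <= 1 + rho) ->
  (limn_esup (fun N => (u N)%:E) <= 1%:E)%E.
Proof.
move=> uC; apply/lee_addgt0Pr => rho rho0; have [n un] := uC rho rho0.
rewrite /limn_esup /limf_esup.
apply: (@le_trans _ _ (ereal_sup ((fun N => (u N)%:E) @` [set k | (n <=
  k)%N]))).
  by apply: ereal_inf_lbound; exists [set k | (n <= k)%N] => //; exists n.
by apply: ge_ereal_sup => _ [N /= nN <-]; rewrite -EFinD lee_fin un.
Qed.

End Limsup.

(** * Maximizers of the log-capital *)

Section LogCapital.
Context {R : realType} {d : nat}.
Implicit Types (s z : seq 'cV[R]_d) (a b v x : 'cV[R]_d).

Lemma log_capital_rcons s x a :
  log_capital (rcons s x) a = log_capital s a + ln (1 + dotv a x).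
Proof. by rewrite /log_capital -cats1 big_cat big_seq1. Qed.

Lemma log_capital_lnE s a : log_capital_dom s a ->
  log_capital s a = ln (\prod_(x <- s) (1 + dotv a x)).
Proof.
move=> sa; rewrite /log_capital.
elim: s sa => [|x s IH] sa; first by rewrite !big_nil ln1.
have sa' : log_capital_dom s a by move=> y ys; apply: sa; rewrite inE ys orbT.
rewrite !big_cons IH // lnM ?posrE //; first by apply: sa; rewrite inE eqxx.
by rewrite big_seq prodr_gt0.
Qed.

Lemma log_capital_dom0 s : log_capital_dom s (0 : 'cV[R]_d).
Proof. by move=> x _; rewrite dot0v addr0 ltr01. Qed.

Lemma log_capital0 s : log_capital s (0 : 'cV[R]_d) = 0.
Proof. by rewrite /log_capital big1 // => x _; rewrite dot0v addr0 ln1. Qed.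

(* Perturbing the maximizer by [t *: v] gives [\sum_x ln (1 + t * y x) <= 0]
   with [y x = v.x / (1 + a.x)]; since [ln (1 + p) >= p / (1 + p)], the
   first-order term [\sum_x y x] cannot be positive. *)
Lemma maximizer_stationary s a v : log_capital_maximizer s a ->
  \sum_(x <- s) dotv v x / (1 + dotv a x) = 0.
Proof.
move=> [sa amax].
suff le0 u : \sum_(x <- s) dotv u x / (1 + dotv a x) <= 0.
  apply: le_anti; rewrite le0 /= -oppr_le0 -sumrN.
  apply: le_trans (le0 (- v)).
  by rewrite le_eqVlt; apply/orP; left; apply/eqP/eq_bigr => x _;
    rewrite dotvNl mulNr.
pose y x := dotv u x / (1 + dotv a x); rewrite -/(\sum_(x <- s) y x).
set Y := \sum_(x <- s) _; rewrite leNgt; apply/negP => Y0.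
pose S := 1 + \sum_(x <- s) `|y x|; pose W := 1 + \sum_(x <- s) y x ^+ 2.
have S1 : 1 <= S by rewrite lerDl sumr_ge0.
have W1 : 1 <= W by rewrite lerDl sumr_ge0 // => x _; exact: sqr_ge0.
(* [t] is small enough for [t * |y x| <= 1/2] at every data point and for [t * W <= Y / 4]; the
   summands 1 in [S] and [W] keep the denominators positive. *)
pose t := Num.min (2 * S)^-1 (Y / (4 * W)).
have S0 : 0 < S by lra.
have W0 : 0 < W by lra.
have t0 : 0 < t by rewrite lt_min invr_gt0 divr_gt0 ?mulr_gt0.
have tS : t * S <= 2^-1.
  have : t <= (2 * S)^-1 by rewrite ge_min lexx.
  by rewrite invfM ler_pdivlMr.
have tW : t * W <= Y / 4.
  have : t <= Y / (4 * W) by rewrite ge_min lexx orbT.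
  by rewrite invfM mulrA ler_pdivlMr.
have yS x : x \in s -> - 2^-1 <= t * y x.
  move=> xs; rewrite lerNl -mulrN; apply: le_trans tS.
  rewrite ler_pM2l // /S (big_rem x) //= addrCA; apply: le_trans (ler_norm _) _.
  by rewrite normrN lerDl addr_ge0 // sumr_ge0.
have factor x : x \in s ->
    1 + dotv (a + t *: u) x = (1 + dotv a x) * (1 + t * y x).
  move=> xs; rewrite dotvDl dotvZl /y; field; rewrite gt_eqF //; exact: sa.
have dom : log_capital_dom s (a + t *: u).
  move=> x xs; rewrite factor // mulr_gt0 ?sa //.
  by have := yS x xs; lra.
(* For [p >= - 1/2] one has [ln (1 + p) >= p / (1 + p) >= p - 2 * p ^+ 2]. By the choice of [t] the
   quadratic part is at most [t * Y / 2], which contradicts [Y > 0]. *)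
have : \sum_(x <- s) (t * y x - 2 * (t * y x) ^+ 2) <= 0.
  have := amax _ dom; rewrite -subr_le0; apply: le_trans.
  rewrite /log_capital -sumrB big_seq [leRHS]big_seq; apply: ler_sum => x xs.
  have p2 := yS x xs; have sax := sa x xs.
  rewrite factor // lnM ?posrE //; last by lra.
  rewrite [leRHS]addrAC subrr add0r; set p := t * y x in p2 *.
  have p1 : 0 < 1 + p by lra.
  have : - ln (1 + p) <= - (p / (1 + p)).
    have -> : - ln (1 + p) = ln (1 + - (p / (1 + p))).
      by rewrite -lnV ?posrE //; congr ln; field; rewrite gt_eqF.
    by rewrite le_ln1Dx // ltrN2 ltr_pdivrMr //; lra.
  rewrite lerN2; apply: le_trans; rewrite ler_pdivlMr //.
  rewrite -subr_ge0 (_ : _ - _ = p ^+ 2 * (1 + 2 * p)); last by ring.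
  by rewrite mulr_ge0 ?sqr_ge0 //; lra.
rewrite sumrB -mulr_sumr -/Y.
under eq_bigr do rewrite exprMn mulrA.
rewrite -mulr_sumr -/Y.
have -> : \sum_(x <- s) y x ^+ 2 = W - 1 by rewrite /W addrC addKr.
by nra.
Qed.

(** Sum [ln_le_quadratic] over the data, expanded at [a]: stationarity cancels the linear terms and
    leaves the quadratic loss. *)
Lemma maximizer_gap s a b M : log_capital_maximizer s a -> log_capital_dom s b
  ->
  (forall x, x \in s -> 1 + dotv a x <= M /\ 1 + dotv b x <= M) ->
  log_capital s b - log_capital s a <=
  - (\sum_(x <- s) dotv (b - a) x ^+ 2) / (2 * M ^+ 2).
Proof.
move=> amax sb sM; have := maximizer_stationary (b - a) amax.
case: amax => sa _ st; rewrite /log_capital -sumrB.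
rewrite [leRHS](_ : _ = \sum_(x <- s) (dotv (b - a) x / (1 + dotv a x)
    - dotv (b - a) x ^+ 2 / (2 * M ^+ 2))); last first.
  by rewrite sumrB st sub0r mulNr mulr_suml.
rewrite big_seq [leRHS]big_seq.
apply: ler_sum => x xs; have [aM bM] := sM x xs.
apply: le_trans (ln_le_quadratic (sa x xs) (sb x xs) aM bM) _.
by rewrite (_ : _ - (1 + _) = dotv (b - a) x) // dotvDl dotvNl; ring.
Qed.

Lemma maximizer_ge s a M : log_capital_maximizer s a ->
  (forall x, x \in s -> 1 + dotv a x <= M) -> 1 <= M ->
  (\sum_(x <- s) dotv a x ^+ 2) / (2 * M ^+ 2) <= log_capital s a.
Proof.
move=> amax sM M1.
have := maximizer_gap (b := 0) (M := M) amax (@log_capital_dom0 s).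
rewrite log_capital0 sub0r mulNr lerN2;
  under eq_bigr do rewrite sub0r dotvNl sqrrN.
by apply => x xs; rewrite dot0v addr0; split => //; exact: sM.
Qed.

(** Passing from [a] to [b], the old data lose quadratically by [maximizer_gap], while the new point
    gains a linear term minus its own square. All these squares together dominate the form of [V],
    so [complete_square] bounds the total whatever [b - a] is. *)
Lemma update_gain s x a b l (V : 'M[R]_d) m M : log_capital_maximizer s a ->
  log_capital_dom (rcons s x) b -> 0 < m -> m <= 1 + dotv a x ->
  (forall y, y \in rcons s x -> 1 + dotv a y <= M /\ 1 + dotv b y <= M) ->
  0 < l -> V^T = V -> coercive l V ->
  (forall v, dotv v (V *m v) <= \sum_(y <- rcons s x) dotv v y ^+ 2) ->
  log_capital (rcons s x) b - log_capital (rcons s x) a <=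
  M ^+ 2 / (2 * m ^+ 2) * dotv x (invmx V *m x).
Proof.
move=> amax xb m0 mx bM l0 sV cV Vle.
have sub y : y \in s -> y \in rcons s x by rewrite mem_rcons inE orbC => ->.
have xx : x \in rcons s x by rewrite mem_rcons mem_head.
have ax : 0 < 1 + dotv a x by apply: lt_le_trans mx.
have [aM bM'] := bM x xx; have M0 : 0 < M by apply: lt_le_trans aM.
have g1 : log_capital s b - log_capital s a <=
    - (\sum_(y <- s) dotv (b - a) y ^+ 2) / (2 * M ^+ 2).
  by apply: maximizer_gap => // y /sub; [exact: xb|exact: bM].
have g2 := ln_le_quadratic ax (xb x xx) aM bM'.
have g3 := Vle (b - a); rewrite -cats1 big_cat big_seq1 /= in g3.
have c0 : 0 < (M ^+ 2)^-1 by rewrite invr_gt0 exprn_gt0.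
have g4 := complete_square ((1 + dotv a x)^-1 *: x) (b - a) l0 sV cV c0.
rewrite -scalemxAr !(dotvZl, dotvZr) (dotvC x (b - a)) in g4.
have q0 : 0 <= dotv x (invmx V *m x).
  have := cV (invmx V *m x); rewrite mulKVmx ?(coercive_unitmx l0) //.
  rewrite (dotvC (_ *m x) x); apply: le_trans.
  by rewrite mulr_ge0 ?(ltW l0) ?dotvv_ge0.
rewrite !log_capital_rcons.
rewrite (_ : 1 + dotv b x - (1 + dotv a x) = dotv (b - a) x) in g2; last first.
  by rewrite dotvDl dotvNl; ring.
move: g1 g2 g3 g4; rewrite invfM mulNr.
set p := dotv (b - a) x; set q := dotv x (invmx V *m x) in q0 *.
set A := \sum_(y <- s) _; set W := dotv (b - a) _ => g1 g2 g3 g4.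
have g3' : (M ^+ 2)^-1 / 2 * W <= A * (2^-1 / M ^+ 2) + p ^+ 2 * (2^-1 / M ^+
  2).
  rewrite (_ : _ / 2 * W = W * (2^-1 / M ^+ 2)); last by ring.
  rewrite -mulrDl; apply: ler_wpM2r => //.
  by rewrite mulr_ge0 ?(ltW c0) // invr_ge0 ler0n.
have g5 : (2 / M ^+ 2)^-1 * ((1 + dotv a x)^-1 * ((1 + dotv a x)^-1 * q)) <=
    M ^+ 2 / (2 * m ^+ 2) * q.
  rewrite mulrA mulrA ler_wpM2r //.
  have -> : (2 / M ^+ 2)^-1 * ((1 + dotv a x)^-1 * (1 + dotv a x)^-1) =
      M ^+ 2 / (2 * (1 + dotv a x) ^+ 2) by field; rewrite !gt_eqF.
  rewrite ler_wpM2l ?exprn_ge0 ?(ltW M0) //.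
  rewrite lef_pV2 ?posrE ?mulr_gt0 ?exprn_gt0 //.
  by rewrite ler_pM2l // !expr2 ler_pM // ltW.
by rewrite invfM in g2; lra.
Qed.

End LogCapital.

(** * Boundedness, existence and safety of the optimizing move under admissible training data *)

Section Game.
Context {R : realType} {d : nat}.
Variables (D : set 'cV[R]_d) (eps0 : R) (z : seq 'cV[R]_d).
Hypothesis D_compact : compact D.
Hypothesis D_origin : interior (convex_hull D) 0.
Hypothesis eps0_gt0 : 0 < eps0.
Hypothesis z_admissible : admissible D eps0 z.

Lemma hull_halfspace (a : 'cV[R]_d) : (forall x, D x -> 0 <= 1 + dotv a x) ->
  forall y, convex_hull D y -> 0 <= 1 + dotv a y.
Proof.
move=> aD; apply: (smallest_sub (X := [set y | 0 <= 1 + dotv a y])) => //.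
move=> u v t /set_mem /= u0 /set_mem /= v0.
have t0 : 0 <= t%:num :> R by exact: ge0.
have t1 : t%:num <= 1 :> R by exact: le1.
apply/mem_set => /=; rewrite /conv /= dotvDr !dotvZr.
rewrite /unstable.onem -subr_ge0.
rewrite (_ : _ - 0 = t%:num * (1 + dotv a u) + (1 - t%:num) * (1 + dotv a v)).
  by rewrite addr_ge0 // mulr_ge0 // subr_ge0.
by ring.
Qed.

Lemma compact_dotv_bounded : exists B, forall x, D x -> dotv x x <= B.
Proof.
have [M [_ DM]] := compact_bounded D_compact.
exists (\sum_(i < d) (`|M| + 1) ^+ 2) => x Dx; rewrite dotvE;
  apply: ler_sum => i _.
have xM : `|x| <= `|M| + 1 by apply: DM => //; rewrite ltr_pwDr // ler_norm.
have xi : `|x i 0| <= `|M| + 1.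
  apply: le_trans xM; rewrite [leRHS]/Num.norm /= mx_normrE.
  exact: (le_bigmax _ (fun ij => `|x ij.1 ij.2|) (i, 0)).
rewrite -expr2 -(real_normK (num_real (x i 0))) !expr2.
by rewrite ler_pM.
Qed.


(** Admissibility carries the constraints from [z] to [D], and [hull_halfspace] carries them to a
    ball around the origin; the points at plus and minus [e / 2] on each axis then bound each
    coordinate by [2 / e]. *)
Lemma training_nonneg_bounded : exists B, forall a : 'cV[R]_d,
  (forall x, x \in z -> 0 <= 1 + dotv a x) -> dotv a a <= B.
Proof.
have /nbhs_ballP[e /= e0 eD] : nbhs (0 : 'cV[R]_d) (convex_hull D)
  by exact: D_origin.
exists (\sum_(i < d) (2 / e) ^+ 2) => a az.
have aD x : D x -> 0 <= 1 + dotv a x.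
  by move=> Dx; apply: le_trans (z_admissible.2 a az x Dx); exact: ltW.
have step (c : R) i : `|c| < e -> 0 <= 1 + c * a i 0.
  move=> ce; have := hull_halfspace aD (y := c *: delta_mx i 0).
  rewrite dotvZr dotv_delta; apply; apply: eD; split => // k l.
  rewrite /ball /= !mxE sub0r normrN normrM; apply: le_lt_trans ce.
  by rewrite ler_piMr // normr_nat lern1 leq_b1.
rewrite dotvE; apply: ler_sum => i _.
have e2 : `|e / 2| < e by rewrite ger0_norm; lra.
have := step _ i e2; rewrite -normrN in e2; have := step _ i e2.
rewrite -expr2 => h1 h2.
have h3 : a i 0 <= 2 / e by rewrite ler_pdivlMr //; nra.
have h4 : - (2 / e) <= a i 0 by rewrite -mulNr ler_pdivrMr //; nra.
move: h3 h4; move: (2 / e) (a i 0) => p q; nra.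
Qed.

(** The product of the factors, unlike the sum of logarithms, is continuous up to the boundary of
    the compact set [S]. It is 1 at the origin, hence positive at its maximum, so no factor vanishes
    there. *)
Lemma maximizer_exists (h : seq 'cV[R]_d) : (forall x, x \in h -> D x) ->
  exists a, log_capital_maximizer (z ++ h) a.
Proof.
move=> hD; have [B zB] := training_nonneg_bounded.
pose S := [set r : 'rV[R]_d | forall x, x \in z -> 0 <= 1 + dotv r^T x].
pose f (r : 'rV[R]_d) := \prod_(x <- z ++ h) (1 + dotv r^T x).
have cfac x : continuous (fun r : 'rV[R]_d => 1 + dotv r^T x).
  exact/continuous_addl/continuous_dotv.
have cS : compact S.
  apply: (@closed_bounded_compact_rV _ _ _ B) => [|r Sr]; last exact: (zB _ Sr).
  rewrite (_ : S = \bigcap_(x in [set` z])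
      (fun r : 'rV[R]_d => 1 + dotv r^T x) @^-1` [set t | 0 <= t]).
    apply: closed_bigI => x _.
    by apply: (continuous_closedP _).1; [exact: cfac|exact: closed_ge].
  by apply/seteqP; split => r.
have S0 : S !=set0 by exists 0 => x _; rewrite trmx0 dot0v addr0.
have cf : continuous f by exact: continuous_prod_seq.
have [c /set_mem Sc cmax] := EVT_max_rV S0 cS (continuous_subspaceT cf).
have f0 : f 0 = 1 by rewrite /f big1 // => x _; rewrite trmx0 dot0v addr0.
have fc : 0 < f c.
  apply: lt_le_trans ltr01 _; rewrite -f0; apply: cmax; apply/mem_set => x _.
  by rewrite trmx0 dot0v addr0.
have domc : log_capital_dom (z ++ h) c^T.
  move=> x xs; rewrite lt_neqAle; apply/andP; split; last first.
    move: xs; rewrite mem_cat => /orP[/Sc //|/hD Dx].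
    by apply: le_trans (z_admissible.2 _ Sc _ Dx); exact: ltW.
  apply: contraTneq fc => x0; rewrite -leNgt /f (big_rem x) //= -x0 mul0r.
  exact: lexx.
exists c^T; split => // b domb.
rewrite !log_capital_lnE // ler_ln ?posrE; last exact: fc.
  have := cmax b^T; rewrite /f trmxK; apply; apply/mem_set => x xz.
  by rewrite trmxK ltW // domb // mem_cat xz.
by rewrite big_seq prodr_gt0.
Qed.

Lemma sequential_optimizingP (h : seq 'cV[R]_d) : (forall x, x \in h -> D x) ->
  log_capital_maximizer (z ++ h) (sequential_optimizing z h).
Proof. by move=> /maximizer_exists[a amax];
  exact: (xgetPex 0 (ex_intro _ a amax)). Qed.

(** Yields prudence, and serves as the crude lower bound on the factors until the moves are known to
    be small. *)
Lemma sequential_optimizing_ge (h : seq 'cV[R]_d) x :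
  (forall y, y \in h -> D y) -> D x ->
  eps0 <= 1 + dotv (sequential_optimizing z h) x.
Proof.
move=> hD Dx; apply: z_admissible.2 Dx => y yz.
by rewrite ltW // (sequential_optimizingP hD).1 // mem_cat yz.
Qed.

End Game.

(** * Growth of the capital along a path *)

Section SumSquares.
Context {R : realType} {d : nat}.
Variable xi : nat -> 'cV[R]_d.

Lemma sum_sq_form N u v : dotv u (sum_sq xi N *m v) =
  \sum_(i < N) dotv u (xi i) * dotv (xi i) v.
Proof.
rewrite /sum_sq mulmx_suml dotv_sumr; apply: eq_bigr => i _.
exact: dotv_rank1.
Qed.

Lemma sum_sq_sym N : (sum_sq xi N)^T = sum_sq xi N.
Proof.
rewrite /sum_sq linear_sum; apply: eq_bigr => i _ /=.
by rewrite trmx_mul trmxK.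
Qed.

Lemma sum_sqS N : sum_sq xi N.+1 = sum_sq xi N + xi N *m (xi N)^T.
Proof. by rewrite /sum_sq big_ord_recr. Qed.

Lemma sum_sq_coercive_le l m n : (m <= n)%N -> coercive l (sum_sq xi m) ->
  coercive l (sum_sq xi n).
Proof.
move=> mn cm; elim: n mn => [|n IH]; first by rewrite leqn0 => /eqP <-.
rewrite leq_eqVlt => /orP[/eqP<- //|/IH cn] u; apply: le_trans (cn u) _.
by rewrite sum_sqS mulmxDl dotvDr dotv_rank1 lerDl (dotvC _ u) -expr2 sqr_ge0.
Qed.

Lemma big_mkseq (F : 'cV[R]_d -> R) N :
  \sum_(x <- mkseq xi N) F x = \sum_(i < N) F (xi i).
Proof.
rewrite /mkseq big_map (_ : iota 0 N = index_iota 0 N) ?big_mkord //.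
by rewrite /index_iota subn0.
Qed.

End SumSquares.

(** For factors in [[1 - de, 1 + de]], the left side is the constant of the total gain and the right
    side that of the growth of the potential; as [de] tends to 0 they tend to [1/2] and
    [(1 + rho) / 2]. *)
Lemma margin_exists (R : realType) (rho : R) : 0 < rho ->
  exists2 de : R, 0 < de < 1 & (1 + de) ^+ 2 / (2 * (1 - de) ^+ 2) <
    (1 - de) ^+ 3 * (1 + rho) / (2 * (1 + de) ^+ 2).
Proof.
(* Cleared of denominators, the claim is [(1 + de)^4 < (1 + rho) (1 - de)^5]. Bounding the powers by
   [1 + 15 de] and [1 - 5 de] reduces it to [15 de + 5 de (1 + rho) < rho], which the factor 30
   ensures. *)
move=> rho0; pose de := rho / (30 * (1 + rho)).
have de0 : 0 < de by rewrite divr_gt0 // mulr_gt0 //; lra.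
have rel : de * (30 * (1 + rho)) = rho by rewrite /de divfK // gt_eqF //; lra.
have de1 : de * 30 < 1 by nra.
have d1 : 0 < 1 - de by lra.
exists de; first by rewrite de0; lra.
have p5 : 1 - 5 * de <= (1 - de) ^+ 5.
  rewrite -subr_ge0 (_ : _ - _ =
    de ^+ 2 * (10 * (1 - de) + de ^+ 2 * (5 - de))); last by ring.
  by rewrite mulr_ge0 ?sqr_ge0 //; have := sqr_ge0 de; nra.
have p4 : (1 + de) ^+ 4 <= 1 + 15 * de.
  have -> : (1 + de) ^+ 4 = 1 + 4 * de + de * (6 * de + 4 * de ^+ 2 + de ^+ 3)
    by ring.
  have h2 : de ^+ 2 <= 1 by rewrite expr_le1 //; lra.
  have h3 : de ^+ 3 <= 1 by rewrite expr_le1 //; lra.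
  have : de * (6 * de + 4 * de ^+ 2 + de ^+ 3) <= de * 11 by rewrite ler_pM2l
    //; lra.
  by lra.
rewrite ltr_pdivrMr ?mulr_gt0 ?exprn_gt0 // mulrAC ltr_pdivlMr; last first.
  by rewrite mulr_gt0 // exprn_gt0 //; lra.
rewrite [ltLHS](_ : _ = 2 * (1 + de) ^+ 4); last by ring.
rewrite [ltRHS](_ : _ = 2 * ((1 + rho) * (1 - de) ^+ 5)); last by ring.
have : (1 + rho) * (1 - 5 * de) <= (1 + rho) * (1 - de) ^+ 5.
  by rewrite ler_pM2l //; lra.
by nra.
Qed.

(** * From a bounded capital to the self-normalized bound along one path *)

Section Path.
Context {R : realType} {d : nat}.
Variables (z : seq 'cV[R]_d) (xi alpha : nat -> 'cV[R]_d).
Hypothesis alphaP : forall n, log_capital_maximizer (z ++ mkseq xi n) (alpha n).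

(** Moves of all times are included, so that a bound for [alpha n] also covers the move that follows
    it. *)
Let point (x : 'cV[R]_d) := x \in z \/ exists i, x = xi i.
Let V N := sum_sq xi N.
Let G N := ln (\det (V N)).
Let Phi N := log_capital (z ++ mkseq xi N) (alpha N).
Let A N := dotv (alpha N) (V N *m alpha N).
Let Q N := dotv (sum_vec xi N) (invmx (V N) *m sum_vec xi N).

(** Potential minus log-capital: each increment is the gain from re-optimizing after one more
    move. *)
Definition excess N := Phi N - \sum_(i < N) ln (1 + dotv (alpha i) (xi i)).

Lemma data_point n x : x \in z ++ mkseq xi n -> point x.
Proof.
rewrite mem_cat => /orP[xz|/mapP[i _ ->]]; [by left|by right; exists i].
Qed.

Lemma dataS n : z ++ mkseq xi n.+1 = rcons (z ++ mkseq xi n) (xi n).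
Proof. by rewrite mkseqS rcons_cat. Qed.

(** [update_gain] applies with [V n.+1], since the training data only add squares to its form;
    [ln_det_rank1] then turns the bound into an increment of [G]. *)
Lemma excess_step n l m M : 0 < l -> coercive l (V n) -> 0 < m ->
  m <= 1 + dotv (alpha n) (xi n) ->
  (forall x, point x -> 1 + dotv (alpha n) x <= M) ->
  (forall x, point x -> 1 + dotv (alpha n.+1) x <= M) ->
  excess n.+1 - excess n <= M ^+ 2 / (2 * m ^+ 2) * (G n.+1 - G n).
Proof.
move=> l0 cV m0 mx M1 M2.
have cV1 : coercive l (V n.+1) by exact: sum_sq_coercive_le cV.
have -> : excess n.+1 - excess n =
    log_capital (rcons (z ++ mkseq xi n) (xi n)) (alpha n.+1)
    - log_capital (rcons (z ++ mkseq xi n) (xi n)) (alpha n).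
  rewrite /excess /Phi big_ord_recr /= dataS (log_capital_rcons _ _ (alpha n)).
  ring.
apply: le_trans (update_gain (V := V n.+1) (M := M) (alphaP n) _ m0 mx _ l0 _
  cV1 _) _.
- by rewrite -dataS; exact: (alphaP n.+1).1.
- by move=> y; rewrite -dataS => /data_point yp; split; [exact: M1|exact: M2].
- exact: sum_sq_sym.
- move=> v; rewrite /V sum_sq_form -dataS big_cat /= big_mkseq.
  rewrite -[leLHS]add0r lerD ?sumr_ge0 // => [x _|]; first exact: sqr_ge0.
  by apply: ler_sum => i _; rewrite (dotvC _ v) expr2.
rewrite ler_wpM2l //;
  last by rewrite /G /V sum_sqS (ln_det_rank1 _ l0) // sum_sq_sym.
by rewrite mulr_ge0 ?sqr_ge0 // invr_ge0 mulr_ge0 // sqr_ge0.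
Qed.

(** Telescoping starts at [n0], so that bounds [m] and [M] holding only eventually can be used. *)
Lemma excess_le n0 N l m M : 0 < l -> coercive l (V n0) -> 0 < m ->
  (forall n, (n0 <= n)%N -> m <= 1 + dotv (alpha n) (xi n)) ->
  (forall n x, (n0 <= n)%N -> point x -> 1 + dotv (alpha n) x <= M) ->
  (n0 <= N)%N ->
  excess N <= excess n0 + M ^+ 2 / (2 * m ^+ 2) * (G N - G n0).
Proof.
move=> l0 cV m0 mb Mb; elim: N => [|N IH].
  by rewrite leqn0 => /eqP ->; rewrite subrr mulr0 addr0.
rewrite leq_eqVlt => /orP[/eqP <-|n0N]; first by rewrite subrr mulr0 addr0.
have cN : coercive l (V N) by exact: sum_sq_coercive_le cV.
have := excess_step l0 cN m0 (mb N n0N) (fun x => Mb N x n0N)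
  (fun x => Mb N.+1 x (leqW n0N)).
have := IH n0N; move: (M ^+ 2 / (2 * m ^+ 2)) => c; lra.
Qed.

Lemma growth_ge_form N M : 1 <= M ->
  (forall x, point x -> 1 + dotv (alpha N) x <= M) ->
  A N / (2 * M ^+ 2) <= Phi N.
Proof.
move=> M1 Mb; apply: le_trans (maximizer_ge (alphaP N) _ M1); last first.
  by move=> x /data_point; exact: Mb.
rewrite ler_wpM2r ?invr_ge0 ?mulr_ge0 ?sqr_ge0 ?(le_trans ler01 M1) //.
rewrite big_cat /= big_mkseq /A /V sum_sq_form.
rewrite -[leLHS]add0r lerD ?sumr_ge0 // => [x _|]; first exact: sqr_ge0.
by apply: ler_sum => i _; rewrite (dotvC _ (alpha N)) expr2.
Qed.

(* With [v = V^-1 s], so that [Q = v.s = v^T V v], stationarity at [alpha N]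
   in direction [v] gives
   [Q = \sum_i (v.x_i) (alpha.x_i) / (1 + alpha.x_i)
        - \sum_(x <- z) (v.x) / (1 + alpha.x)];
   both sums are then estimated by AM-GM. *)
Lemma self_normalized_le N l delta B : 0 < l -> coercive l (V N) ->
  0 < delta -> delta < 1 ->
  (forall x, point x -> `|dotv (alpha N) x| <= delta) ->
  0 < B -> (forall x, x \in z -> dotv x x <= B) -> (0 < size z)%N ->
  (1 - delta) * Q N <= A N / (1 - delta) ^+ 2
    + (size z)%:R ^+ 2 * B / (delta * (1 - delta) ^+ 2 * l).
Proof.
move=> l0 cV de0 de1 ade B0 zB z0.
have uV : V N \in unitmx by apply: coercive_unitmx cV => //; exact: sum_sq_sym.
pose v := invmx (V N) *m sum_vec xi N.
have Vv : V N *m v = sum_vec xi N by rewrite mulKVmx.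
have Qv : Q N = dotv v (V N *m v) by rewrite Vv dotvC.
have Qs : Q N = \sum_(i < N) dotv v (xi i).
  by rewrite Qv Vv /sum_vec dotv_sumr.
have Qsq : Q N = \sum_(i < N) dotv v (xi i) ^+ 2.
  by rewrite Qv sum_sq_form; apply: eq_bigr => i _; rewrite (dotvC _ v) expr2.
have Asq : A N = \sum_(i < N) dotv (alpha N) (xi i) ^+ 2.
  by rewrite /A sum_sq_form; apply: eq_bigr => i _;
    rewrite (dotvC _ (alpha N)) expr2.
have lo x : point x -> 1 - delta <= 1 + dotv (alpha N) x.
  by move=> /ade; rewrite ler_norml => /andP[+ _]; lra.
have pos x : point x -> 0 < 1 + dotv (alpha N) x.
  by move=> /lo; lra.
have de2 : 0 < 1 - delta by lra.
have inv2 x : point x -> ((1 + dotv (alpha N) x) ^+ 2)^-1 <= ((1 - delta) ^+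
  2)^-1.
  move=> px; rewrite lef_pV2 ?posrE ?exprn_gt0 ?pos //.
  by rewrite !expr2 ler_pM ?lo // ltW.
have st := maximizer_stationary v (alphaP N).
rewrite big_cat /= big_mkseq in st.
have k0 : 0 < (size z)%:R :> R by rewrite ltr0n.
set k := (size z)%:R in k0 *.
(* This makes the [dotv v v] part of the training term equal to [delta / 2 * (l * dotv v v)], which
   coercivity absorbs into [delta / 2 * Q N]. *)
pose eta := delta * l / (k * B).
have eta0 : 0 < eta by rewrite /eta divr_gt0 ?mulr_gt0.
pose i2 := ((1 - delta) ^+ 2)^-1.
have P2 : - \sum_(x <- z) dotv v x / (1 + dotv (alpha N) x) <=
    k * (eta / 2 * B * dotv v v + i2 / (2 * eta)).
  rewrite -sumrN /k -sum1_size natr_sum mulr_suml big_seq [leRHS]big_seq.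
  apply: ler_sum => x xz; rewrite mul1r.
  have px : point x by left.
  have h1 := inv2 x px; have h2 := cauchy_schwarz v x.
  have h3 : dotv v x ^+ 2 <= B * dotv v v.
    by apply: le_trans h2 _; rewrite mulrC ler_wpM2r ?zB ?dotvv_ge0.
  have h4 : eta / 2 * dotv v x ^+ 2 <= eta / 2 * B * dotv v v.
    by rewrite -[leRHS]mulrA ler_wpM2l // divr_ge0 // ltW.
  have h5 : ((1 + dotv (alpha N) x) ^+ 2)^-1 / (2 * eta) <= i2 / (2 * eta).
    by rewrite ler_wpM2r // invr_ge0 mulr_ge0 // ltW.
  apply: le_trans (lerD h4 h5); rewrite -subr_ge0.
  have px0 := pos x px; move: (1 + dotv (alpha N) x) (dotv v x) px0 => p w p0.
  rewrite (_ : _ - _ = (eta * w + p^-1) ^+ 2 / (2 * eta)); last first.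
    by field; rewrite !gt_eqF.
  by rewrite divr_ge0 ?sqr_ge0 // mulr_ge0 // ltW.
have P1 : \sum_(i < N) dotv v (xi i) * dotv (alpha N) (xi i)
      / (1 + dotv (alpha N) (xi i)) <= Q N / 2 + i2 / 2 * A N.
  rewrite Qsq Asq mulr_suml mulr_sumr -big_split /=; apply: ler_sum => i _.
  have px : point (xi i) by right; exists i.
  have px0 := pos _ px; have h1 := inv2 _ px.
  set p := 1 + _ in px0 h1 *; set w := dotv v _; set a := dotv (alpha N) _.
  have h2 : (p ^+ 2)^-1 / 2 * a ^+ 2 <= i2 / 2 * a ^+ 2.
    by rewrite ler_wpM2r ?sqr_ge0 // ler_wpM2r.
  apply: le_trans (lerD (lexx _) h2); rewrite -subr_ge0.
  rewrite (_ : _ - _ = (w - a / p) ^+ 2 / 2); last by field; rewrite gt_eqF.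
  by rewrite divr_ge0 ?sqr_ge0.
(* Sum [w * a / (1 + a) = w - w / (1 + a)] over the moves; stationarity turns the last sum into
   minus the training sum. *)
have split : Q N = \sum_(i < N) dotv v (xi i) * dotv (alpha N) (xi i)
      / (1 + dotv (alpha N) (xi i))
    - \sum_(x <- z) dotv v x / (1 + dotv (alpha N) x).
  have e : \sum_(i < N) dotv v (xi i) * dotv (alpha N) (xi i)
      / (1 + dotv (alpha N) (xi i)) =
      Q N - \sum_(i < N) dotv v (xi i) / (1 + dotv (alpha N) (xi i)).
    rewrite Qs -sumrB; apply: eq_bigr => i _.
    have p0 : 0 < 1 + dotv (alpha N) (xi i) by apply: pos; right; exists i.
    by field; rewrite gt_eqF.
  by rewrite e; move: st; lra.
have lv : l * dotv v v <= Q N by rewrite Qv; exact: cV.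
have P3 : k * (eta / 2 * B * dotv v v + i2 / (2 * eta)) <=
    delta / 2 * Q N + k ^+ 2 * B * i2 / (2 * (delta * l)).
  have -> : k * (eta / 2 * B * dotv v v + i2 / (2 * eta)) =
      delta / 2 * (l * dotv v v) + k ^+ 2 * B * i2 / (2 * (delta * l)).
    by rewrite /eta; field; rewrite !gt_eqF.
  by rewrite lerD2r ler_wpM2l // divr_ge0 // ltW.
have -> : k ^+ 2 * B / (delta * (1 - delta) ^+ 2 * l) =
    2 * (k ^+ 2 * B * i2 / (2 * (delta * l))).
  by rewrite /i2; field; rewrite !gt_eqF.
rewrite mulrC (_ : A N / _ = 2 * (i2 / 2 * A N)); last by rewrite /i2; field;
  rewrite gt_eqF.
by move: P1 P2 P3; rewrite {1}split; lra.
Qed.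

Hypothesis z_gt0 : (0 < size z)%N.
Variables (B eps0 : R).
Hypothesis B_gt0 : 0 < B.
Hypothesis point_le : forall x, point x -> dotv x x <= B.
Hypothesis alpha_le : forall n, dotv (alpha n) (alpha n) <= B.
Hypothesis eps0_gt0 : 0 < eps0.
Hypothesis alpha_ge : forall n, eps0 <= 1 + dotv (alpha n) (xi n).
Variables (l : nat -> R) (n0 : nat).
Hypothesis l_gt0 : forall N, (n0 <= N)%N -> 0 < l N.
Hypothesis l_coercive : forall N, (n0 <= N)%N -> coercive (l N) (V N).
Hypothesis G_small : forall e, 0 < e ->
  exists n, forall N, (n <= N)%N -> 1 <= e * l N /\ G N <= e * l N.
Variables (C0 : R) (n1 : nat).
Hypothesis capital_le : forall N, (n1 <= N)%N ->
  \sum_(i < N) ln (1 + dotv (alpha i) (xi i)) <= C0.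

(* A bounded capital forces [A N = O(1 + G N)], while
   [A N >= l N * |alpha|^2]. *)
Lemma alpha_vanishes t : 0 < t ->
  exists n, forall N, (n <= N)%N -> dotv (alpha N) (alpha N) <= t.
Proof.
move=> t0; pose M := 1 + B; have M1 : 1 <= M by rewrite lerDl ltW.
have aM n x : point x -> 1 + dotv (alpha n) x <= M.
  move=> /point_le xB; have aB := alpha_le n.
  have := dotvv_ge0 (alpha n - x); rewrite !(dotvDl, dotvDr, dotvNl, dotvNr).
  by rewrite (dotvC x (alpha n)) /M; lra.
pose c := M ^+ 2 / (2 * eps0 ^+ 2).
have c0 : 0 <= c by rewrite divr_ge0 ?sqr_ge0 // mulr_ge0 // sqr_ge0.
pose C := `|excess n0 - c * G n0 + C0|.
have Cge : excess n0 - c * G n0 + C0 <= C by exact: ler_norm.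
have C_ge0 : 0 <= C by exact: normr_ge0.
(* [C + c * G N] will be at most [(C + c + 1) * (e * l N)], and [2 * M ^+ 2] times the latter is
   [t * l N]. *)
pose e := t / (2 * M ^+ 2 * (C + c + 1)).
have M2 : 0 < 2 * M ^+ 2 by rewrite mulr_gt0 // exprn_gt0 //; lra.
have e0 : 0 < e by rewrite divr_gt0 // mulr_gt0 //; lra.
have [n2 small] := G_small e0.
exists (maxn n0 (maxn n1 n2)) => N; rewrite !geq_max => /and3P[N0 N1 N2].
have [le1 Ge] := small N N2; have lN := l_gt0 N0.
have ex := excess_le (l_gt0 (leqnn n0)) (l_coercive (leqnn n0)) eps0_gt0
  (fun n _ => alpha_ge n) (fun n x _ => aM n x) N0.
have cap := capital_le N1.
have gr := growth_ge_form M1 (aM N); rewrite ler_pdivrMr // in gr.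
have low := l_coercive N0 (alpha N); rewrite -/(A N) in low.
have Phi_le : Phi N <= C + c * G N.
  by move: ex cap Cge; rewrite -/c /excess; lra.
have bound : C + c * G N <= (C + c + 1) * (e * l N) by nra.
have te : 2 * M ^+ 2 * (C + c + 1) * e = t.
  by rewrite /e mulrC mulfVK // gt_eqF // mulr_gt0 //; lra.
rewrite -(ler_pM2l lN); apply: le_trans low _; apply: le_trans gr _.
apply: (@le_trans _ _ ((C + c + 1) * (e * l N) * (2 * M ^+ 2))).
  by rewrite ler_wpM2r ?(ltW M2) // (le_trans Phi_le).
by rewrite -te le_eqVlt; apply/orP; left; apply/eqP; ring.
Qed.

Hypothesis G_large : forall C, exists n, forall N, (n <= N)%N -> C <= G N.

(** Second pass, with factors in [[1 - de, 1 + de]]. If [Q N] exceeded [(1 + rho) * G N], then up to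
    constants [Phi N] would be at least [kappa * G N], while the gain bound and the bounded capital
    keep it below [c * G N]; as [c < kappa], this fails once [G N] is large. *)
Lemma self_normalized_eventually rho : 0 < rho ->
  exists n, forall N, (n <= N)%N -> Q N <= (1 + rho) * G N.
Proof.
move=> rho0; have [de /andP[de0 de1] margin] := margin_exists rho0.
have [na asmall] := alpha_vanishes (divr_gt0 (exprn_gt0 2 de0) B_gt0).
have ade N x : (na <= N)%N -> point x -> `|dotv (alpha N) x| <= de.
  move=> /asmall aN /point_le xB.
  rewrite -(ler_pXn2r (n := 2)) ?nnegrE ?normr_ge0 ?(ltW de0) //.
  rewrite real_normK ?num_real //; apply: le_trans (cauchy_schwarz _ _) _.
  rewrite -(divfK (lt0r_neq0 B_gt0) (de ^+ 2)) ler_pM ?dotvv_ge0 //.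
have d1 : 0 < 1 - de by lra.
have k0 : 0 < (size z)%:R :> R by rewrite ltr0n.
(* With this [e], the training remainder in [self_normalized_le] is at most 1 as soon as
   [1 <= e * l N]. *)
pose e := de * (1 - de) ^+ 2 / ((size z)%:R ^+ 2 * B).
have e0 : 0 < e by rewrite divr_gt0 ?mulr_gt0 ?exprn_gt0.
have [nl lsmall] := G_small e0.
pose n3 := maxn n0 na.
have n03 : (n0 <= n3)%N by rewrite leq_maxl.
set c := (1 + de) ^+ 2 / (2 * (1 - de) ^+ 2) in margin.
have ade3 n x : (n3 <= n)%N -> point x -> - de <= dotv (alpha n) x <= de.
  by rewrite geq_max -ler_norml => /andP[_]; exact: ade.
have ex N : (n3 <= N)%N -> excess N <= excess n3 + c * (G N - G n3).
  apply: (excess_le (l_gt0 n03) (l_coercive n03)) => // [n nn3|n x nn3 px].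
    have /andP[+ _] := ade3 n (xi n) nn3 (or_intror (ex_intro _ n erefl)).
    by lra.
  by have /andP[_ +] := ade3 n x nn3 px; rewrite lerD2l.
set kappa := (1 - de) ^+ 3 * (1 + rho) / (2 * (1 + de) ^+ 2) in margin.
(* [C] collects the constants: the two bounds on [Phi N] will give [(kappa - c) * G N <= C], against
   the threshold [C + 1] imposed next. *)
pose C := C0 + excess n3 - c * G n3 + (1 - de) ^+ 2 / (2 * (1 + de) ^+ 2).
have [ng Glarge] := G_large ((C + 1) / (kappa - c)).
exists (maxn n1 (maxn n3 (maxn nl ng))) => N.
rewrite !geq_max -[(n0 <= N)%N && _]geq_max => /and4P[N1 N3 Nl Ng].
have N0 : (n0 <= N)%N by apply: leq_trans N3.
rewrite leNgt; apply/negP => QG.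
have gN := Glarge N Ng; rewrite ler_pdivrMr ?subr_gt0 // in gN.
have cap := capital_le N1; have exN := ex N N3.
have adeN x : point x -> `|dotv (alpha N) x| <= de.
  by rewrite ler_norml; exact: ade3.
have gr : A N / (2 * (1 + de) ^+ 2) <= Phi N.
  apply: growth_ge_form => [|x /adeN]; first by rewrite lerDl ltW.
  by rewrite ler_norml => /andP[_ +]; rewrite lerD2l.
have sn := self_normalized_le (l_gt0 N0) (l_coercive N0) de0 de1 adeN B_gt0
  (fun x xz => point_le (or_introl xz)) z_gt0.
have tail : (size z)%:R ^+ 2 * B / (de * (1 - de) ^+ 2 * l N) <= 1.
  have [+ _] := lsmall N Nl; have lN := l_gt0 N0.
  rewrite ler_pdivrMr ?mulr_gt0 ?exprn_gt0 // mul1r.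
  by rewrite /e mulrAC ler_pdivlMr ?mulr_gt0 ?exprn_gt0 // mul1r.
have Age : (1 - de) ^+ 2 * ((1 - de) * ((1 + rho) * G N) - 1) <= A N.
  have h : (1 - de) * ((1 + rho) * G N) - 1 <= A N / (1 - de) ^+ 2.
    have : (1 - de) * ((1 + rho) * G N) <= (1 - de) * Q N.
      by rewrite ler_pM2l // ltW.
    by move: sn tail; lra.
  by rewrite mulrC -ler_pdivlMr // exprn_gt0.
have e1 : 0 < 2 * (1 + de) ^+ 2 by rewrite mulr_gt0 // exprn_gt0 //; lra.
have kG : kappa * G N - (1 - de) ^+ 2 / (2 * (1 + de) ^+ 2) <= Phi N.
  apply: le_trans gr; rewrite ler_pdivlMr //; apply: le_trans Age.
  rewrite le_eqVlt; apply/orP; left; apply/eqP; rewrite /kappa; field.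
  by rewrite gt_eqF //; lra.
rewrite {1}/excess in exN; move: gN kG exN cap; rewrite /C; lra.
Qed.

End Path.

(** * Growth of the determinant on the eigenvalue event *)

Section EigenvalueGrowth.
Context {R : realType} {d : nat}.
Variables (xi : nat -> 'cV[R]_d) (n0 : nat).
Hypothesis d_gt0 : (0 < d)%N.
Let V N := sum_sq xi N.
Let G N := ln (\det (V N)).
Let lmin N := lambda_min (V N).
Let lmax N := lambda_max (V N).
Hypothesis lmin_gt0 : forall N, (n0 <= N)%N -> 0 < lmin N.
Hypothesis ln_lmax : (fun N => ln (lmax N) / lmin N) @ \oo --> (0 : R).

Lemma lmin_coercive N : coercive (lmin N) (V N).
Proof. by apply: lambda_min_coercive => //; exact: sum_sq_sym. Qed.

Lemma ln_det_sum_sq_le m N : (n0 <= m)%N -> (m <= N)%N -> G m <= G N.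
Proof.
move=> n0m; elim: N => [|N IH]; first by rewrite leqn0 => /eqP ->.
rewrite leq_eqVlt => /orP[/eqP -> //|mN]; apply: le_trans (IH mN) _.
have l0 := lmin_gt0 (leq_trans n0m mN).
rewrite -subr_ge0 /G /V sum_sqS.
apply: le_trans (ln_det_rank1 _ l0 (sum_sq_sym _ _) (lmin_coercive N)).
have cW := sum_sq_coercive_le (leqnSn N) (lmin_coercive N).
rewrite -sum_sqS; set x := xi N; set W := sum_sq xi N.+1 in cW *.
have sW : W^T = W by exact: sum_sq_sym.
have := cW (invmx W *m x); rewrite mulKVmx ?(coercive_unitmx l0) // dotvC.
by apply: le_trans; rewrite mulr_ge0 ?(ltW l0) ?dotvv_ge0.
Qed.

Lemma ln_det_le_lmax N : (n0 <= N)%N -> G N <= d%:R * ln (lmax N).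
Proof.
move=> N0; have l0 := lmin_gt0 N0; have sV : (V N)^T = V N by exact: sum_sq_sym.
have le u : dotv u (V N *m u) <= lmax N * dotv u u by exact: lambda_max_ge.
have L0 : 0 < lmax N.
  pose u : 'cV[R]_d := delta_mx (Ordinal d_gt0) 0.
  have u1 : dotv u u = 1 by rewrite dotv_delta mxE !eqxx.
  have := le_trans (lmin_coercive N u) (le u).
  by rewrite u1 !mulr1; exact: lt_le_trans.
have dV := coercive_det_gt0 l0 sV (lmin_coercive N).
rewrite mulr_natl -lnXn // ler_ln ?posrE ?exprn_gt0 //.
exact: (det_le_bounded l0 sV (lmin_coercive N) le).
Qed.

Variable n1 : nat.
Hypothesis n01 : (n0 <= n1)%N.
Hypothesis G_gt0 : 0 < G n1.

(** Monotonicity gives [0 < G n1 <= G N <= d * ln (lmax N)], and the right side is negligible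
    against [lmin N]; hence [lmin] tends to infinity and dominates [G]. *)
Lemma lmin_dominates e : 0 < e ->
  exists n, forall N, (n <= N)%N -> 1 <= e * lmin N /\ G N <= e * lmin N.
Proof.
move=> e0; have dR : 0 < d%:R :> R by rewrite ltr0n.
(* The first term serves [G N <= e * lmin N]; the second gives [G n1 <= e * G n1 * lmin N], from
   which [G n1] cancels. *)
pose e' := Num.min (e / d%:R) (e * G n1 / d%:R).
have e'0 : 0 < e' by rewrite lt_min !divr_gt0 ?mulr_gt0.
have [n _ small] := cvgr0_norm_le _ ln_lmax _ e'0.
exists (maxn n1 n) => N; rewrite geq_max => /andP[N1 Nn].
have N0 : (n0 <= N)%N by apply: leq_trans N1.
have l0 := lmin_gt0 N0.
have lnle : ln (lmax N) <= e' * lmin N.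
  by rewrite -ler_pdivrMr //; apply: le_trans (ler_norm _) (small N Nn).
have Gle : G N <= d%:R * (e' * lmin N).
  by apply: le_trans (ln_det_le_lmax N0) _; rewrite ler_pM2l.
have e1 : d%:R * e' <= e by rewrite mulrC -ler_pdivlMr // ge_min lexx.
have e2 : d%:R * e' <= e * G n1.
  by rewrite mulrC -ler_pdivlMr // ge_min lexx orbT.
split; last first.
  by apply: le_trans Gle _; rewrite mulrA ler_wpM2r // ltW.
have := le_trans (ln_det_sum_sq_le n01 N1) Gle.
rewrite mulrA => /le_trans/(_ (ler_wpM2r (ltW l0) e2)).
by rewrite mulrAC ler_pMl.
Qed.

(** Eventually [lmin N >= expR |C|], and the determinant is at least [lmin N ^+ d] with [d >= 1]. *)
Lemma ln_det_unbounded C : exists n, forall N, (n <= N)%N -> C <= G N.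
Proof.
have [n big] := lmin_dominates (expR_gt0 (- `|C|)).
exists (maxn n0 n) => N; rewrite geq_max => /andP[N0 /big[+ _]].
have l0 := lmin_gt0 N0;
  rewrite expRN mulrC ler_pdivlMr ?expR_gt0 // mul1r => El.
have sV : (V N)^T = V N by exact: sum_sq_sym.
have dV := coercive_det_gt0 l0 sV (lmin_coercive N).
have Cl : `|C| <= ln (lmin N) by rewrite -ler_expR lnK.
have ln0 := le_trans (normr_ge0 C) Cl.
apply: le_trans (ler_norm C) _; apply: le_trans Cl _.
apply: (@le_trans _ _ (ln (lmin N ^+ d))).
  by rewrite lnXn // -mulr_natl ler_peMl ?ler1n.
rewrite ler_ln ?posrE ?exprn_gt0 //.
exact: det_ge_coercive (lmin_coercive N).
Qed.

End EigenvalueGrowth.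

Theorem theorem2p2 (R : realType) (d : nat) (D : set 'cV[R]_d) (eps0 : R)
    (z : seq 'cV[R]_d)
    (d_gt0 : (0 < d)%N)
    (D_compact : compact D)
    (D_origin : interior (convex_hull D) 0)
    (eps0_gt0 : 0 < eps0) (eps0_lt1 : eps0 < 1)
    (z_admissible : admissible D eps0 z) :
  weakly_forces D (sequential_optimizing z)
    (~` @eigenvalue_event R d `|` @self_normalized_event R d).
Proof.
have mkD xi n : path_in D xi -> forall x, x \in mkseq xi n -> D x.
  by move=> xiD x /mapP[i _ ->].
have factor_ge xi n : path_in D xi ->
    eps0 <= 1 + dotv (sequential_optimizing z (mkseq xi n)) (xi n).
  by move=> xiD; apply: (sequential_optimizing_ge D_origin eps0_gt0
    z_admissible);
    [exact: mkD|exact: xiD].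
split=> [xi xiD N|xi xiD].
  by apply: prodr_ge0 => i _; apply: le_trans (factor_ge xi i xiD); exact: ltW.
rewrite /setU /setC /= => /not_orP[/contrapT[[n0 _ lmin0] lnl] nSN].
(* By contraposition: a capital that is not unbounded stays below some [C] from some [n1] on, and
   the bound on the upper limit has to follow. *)
apply: limn_esup_pinfty => C n1; apply: contrapT => capC; apply: nSN.
have capC' N : (n1 <= N)%N -> capital (sequential_optimizing z) xi N <= C.
  by move=> n1N; rewrite leNgt; apply/negP => CN; apply: capC; exists N => //;
    exact: ltW.
apply: limn_esup_le1 => rho rho0.
pose G N := ln (\det (sum_sq xi N)).
pose Q N := dotv (sum_vec xi N) (invmx (sum_sq xi N) *m sum_vec xi N).
have QE N : ((sum_vec xi N)^T *m invmx (sum_sq xi N) *m sum_vec xi N) 0 0 = Q N.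
  by rewrite /Q /dotv mulmxA.
have lN N : (n0 <= N)%N -> 0 < lambda_min (sum_sq xi N) by exact: lmin0.
(* If [G] is never positive from [n0] on, each quotient is at most 0, as [Q] is nonnegative and
   [x / 0 = 0]. *)
have [[n2 [n02 G0]]|Gle] := pselect (exists n2, (n0 <= n2)%N /\ 0 < G n2);
  last first.
  exists n0 => N N0; rewrite QE -/(G N); apply: (@le_trans _ _ 0); last by lra.
  have GN : G N <= 0 by rewrite leNgt; apply/negP => GN; apply: Gle; exists N.
  rewrite mulr_ge0_le0 ?invr_le0 // /Q.
  have cV := lmin_coercive xi d_gt0 N.
  have := cV (invmx (sum_sq xi N) *m sum_vec xi N).
  rewrite mulKVmx ?(coercive_unitmx (lN N N0)) ?sum_sq_sym // dotvC.
  by apply: le_trans; rewrite mulr_ge0 ?dotvv_ge0 // ltW // lN.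
pose alpha n := sequential_optimizing z (mkseq xi n).
have alphaP n : log_capital_maximizer (z ++ mkseq xi n) (alpha n).
  exact: (sequential_optimizingP D_origin eps0_gt0 z_admissible (mkD xi n xiD)).
have [B1 B1P] := compact_dotv_bounded D_compact.
have [B2 B2P] := training_nonneg_bounded D_origin eps0_gt0 z_admissible.
(* A single bound for Reality's moves, the strategy and the training data; the 1 makes it
   positive. *)
pose B := 1 + `|B1| + `|B2| + \sum_(x <- z) dotv x x.
have sz0 : 0 <= \sum_(x <- z) dotv x x by apply: sumr_ge0 => x _;
  exact: dotvv_ge0.
have nB1 := normr_ge0 B1; have nB2 := normr_ge0 B2.
have B1B : B1 <= B by have := ler_norm B1; rewrite /B; lra.
have B2B : B2 <= B by have := ler_norm B2; rewrite /B; lra.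
have B0 : 0 < B by rewrite /B; lra.
have pointB x : x \in z \/ (exists i, x = xi i) -> dotv x x <= B.
  move=> [xz|[i ->]]; last by apply: le_trans B1B; exact/B1P/xiD.
  rewrite /B (big_rem x) //= addrCA lerDl addr_ge0 ?addr_ge0 //.
  by apply: sumr_ge0 => y _; exact: dotvv_ge0.
have alphaB n : dotv (alpha n) (alpha n) <= B.
  apply: le_trans B2B; apply: B2P => x xz.
  by rewrite ltW // (alphaP n).1 // mem_cat xz.
have z0 : (0 < size z)%N by apply: leq_trans z_admissible.1.
have fac0 n : 0 < 1 + dotv (alpha n) (xi n).
  by apply: lt_le_trans (factor_ge xi n xiD).
have lncap N : (n1 <= N)%N ->
    \sum_(i < N) ln (1 + dotv (alpha i) (xi i)) <= C.
  move=> /capC'; apply: le_trans; rewrite /capital.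
  have -> : \sum_(i < N) ln (1 + dotv (alpha i) (xi i)) =
      ln (\prod_(i < N) (1 + dotv (alpha i) (xi i))).
    elim: N => [|N IH]; first by rewrite !big_ord0 ln1.
    by rewrite !big_ord_recr /= IH lnM ?posrE ?prodr_gt0.
  (* Since [ln y < y], the bound on the capital also bounds its logarithm. *)
  by apply/ltW/ln_sublinear/prodr_gt0.
have [na Qle] := self_normalized_eventually alphaP z0 B0 pointB alphaB eps0_gt0
  (fun n => factor_ge xi n xiD) lN (fun N _ => lmin_coercive xi d_gt0 N)
  (lmin_dominates d_gt0 lN lnl n02 G0) lncap
  (ln_det_unbounded d_gt0 lN lnl n02 G0) rho0.
have [nb G1] := ln_det_unbounded d_gt0 lN lnl n02 G0 1.
exists (maxn na nb) => N; rewrite geq_max => /andP[/Qle QN /G1 GN].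
by rewrite QE ler_pdivrMr //; apply: lt_le_trans GN.
Qed.
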